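(* Let $\mathcal V,\mathcal W\subset\mathcal H$ be finite dimensional subspaces of a complex separable Hilbert space $\mathcal H$ with $\mathcal V\oplus\mathcal W^\perp=\mathcal H$, $d=\dim\mathcal V=\dim\mathcal W$, and let $0\le\theta_1\le\dots\le\theta_d<\pi/2$ be the principal angles between $\mathcal V$ and $\mathcal W$. Then the aliasing norm satisfies $$A(\mathcal W,\mathcal V)=\tan(\theta_d).$$
   Context: $\mathcal V\oplus\mathcal W^\perp=\mathcal H$ means $\mathcal V+\mathcal W^\perp=\mathcal H$ and $\mathcal V\cap\mathcal W^\perp=\{0\}$; equivalently $\mathcal W\oplus\mathcal V^\perp=\mathcal H$. $P_{\mathcal S}$ is the orthogonal projection onto $\mathcal S$ and $P_{\mathcal W//\mathcal V^\perp}$ is the oblique projection with range $\mathcal W$ and null space $\mathcal V^\perp$. The principal angles $0\le\theta_1\le\dots\le\theta_d\le\pi/2$ are such that the $d$ largest singular values of $P_{\mathcal W}P_{\mathcal V}$, in non-increasing order, are $\cos\theta_1,\dots,\cos\theta_d$; under the assumption $\mathcal V\oplus\mathcal W^\perp=\mathcal H$ one has $\theta_d<\pi/2$. The aliasing norm associated with the consistent sampling $f\mapsto P_{\mathcal W//\mathcal V^\perp}f$ is $$A(\mathcal W,\mathcal V)=\sup_{e\in\mathcal W^\perp\setminus\{0\}}\frac{\|P_{\mathcal W//\mathcal V^\perp}e\|}{\|e\|}=\|P_{\mathcal W//\mathcal V^\perp}P_{\mathcal W^\perp}\|$$ (interpreted as $0$ if $\mathcal W^\perp=\{0\}$). *)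

(* Defs.v *)
From HB Require Import structures.
From mathcomp Require Import all_boot all_order all_algebra.
From mathcomp Require Import complex.
From mathcomp Require Import all_classical all_reals all_analysis.

Set Implicit Arguments.
Unset Strict Implicit.
Unset Printing Implicit Defensive.

Import Order.TTheory GRing.Theory Num.Theory.
Import numFieldNormedType.Exports.

Local Open Scope classical_set_scope.
Local Open Scope ring_scope.
Local Open Scope complex_scope.

Definition separable_space (T : topologicalType) : Prop :=
  exists2 D : set T, countable D & dense D.

Section Hilbert.
Context {R : realType} {H : completeNormedModType R[i]}.
Implicit Types (V W N : set H) (T : H -> H).

(* The norm of H takes its (nonnegative real) values in R[i]. *)
Definition rnorm (x : H) : R := complex.Re `|x|.

Definition lin_indep d (b : 'I_d -> H) : Prop :=
  forall c : 'I_d -> R[i], \sum_(i < d) c i *: b i = 0 -> forall i, c i = 0.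

Definition lin_span d (b : 'I_d -> H) : set H :=
  [set x | exists c : 'I_d -> R[i], x = \sum_(i < d) c i *: b i].

Definition subspace_of_dim V (d : nat) : Prop :=
  exists2 b : 'I_d -> H, lin_indep b & V = lin_span b.

Definition direct_sum_eq_all V N : Prop :=
  [set v + n | v in V & n in N] = [set: H] /\ V `&` N = [set 0].

(* P_{V//N}: the component in V along N, unique as soon as V and N are subspaces
   with V (+) N = H. *)
Definition oblique_proj V N (x : H) : H :=
  xget 0 [set y | V y /\ N (x - y)].

Section InnerProduct.
Variable dot : {dot H for Num.Def.conjC}.

Definition orthocompl V : set H :=
  [set x | forall v, V v -> dot x v = 0].

Definition orth_proj V : H -> H := oblique_proj V (orthocompl V).

(* The adjoint T^*; the value z is unique because dot is definite, and it exists
   for every y when T is linear and bounded. *)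
Definition adjoint T (y : H) : H :=
  xget 0 [set z | forall x, dot (T x) y = dot x z].

(* t^2 is an eigenvalue of T^* T, with eigenvector v. *)
Definition singular_pair T (t : R) (v : H) : Prop :=
  [/\ 0 <= t, v != 0 & adjoint T (T v) = (t ^+ 2)%:C *: v].

(* s lists the d largest singular values of the (compact) operator T, counted
   with multiplicity: the s i belong to orthonormal eigenvectors u i of T^* T,
   and the eigenvectors orthogonal to all the u i only contribute singular values
   that do not exceed any s i. *)
Definition largest_singular_values T d (s : 'I_d -> R) : Prop :=
  {homo s : i j / (i <= j)%N >-> j <= i} /\
  exists u : 'I_d -> H,
    [/\ orthonormal dot (codom u),
        forall i, singular_pair T (s i) (u i) &
        forall t v, singular_pair T t v -> (forall i, dot v (u i) = 0) ->
          forall i, t <= s i].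

Definition principal_angles V W d (theta : 'I_d -> R) : Prop :=
  [/\ forall i, 0 <= theta i <= pi / 2,
      {homo theta : i j / (i <= j)%N >-> i <= j} &
      largest_singular_values (orth_proj W \o orth_proj V)
        (fun i => cos (theta i))].

Definition aliasing_norm W V : \bar R :=
  if `[< orthocompl W = [set 0] >] then 0%E else
  ereal_sup [set (rnorm (oblique_proj W (orthocompl V) e) / rnorm e)%:E
            | e in orthocompl W `\ 0].

End InnerProduct.
End Hilbert.

(* Main.v *)
(* Let K = P_V P_W P_V be the Gram operator of P_W P_V. Since V and W^perp meet
   trivially, K is positive definite on V, so the d largest singular values are
   all positive and the corresponding singular vectors form an orthonormal basis
   of V; hence |P_W v| >= c |v| on V with c = cos theta_d.
   For e in W^perp put w = P_{W//V^perp} e and write w = v + n with v in V and n in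
   W^perp. Then P_W v = w, so |n| <= tan theta_d |w|, while |w|^2 = - <e, n>; this
   gives |w| <= tan theta_d |e|. If v is the last singular vector, the error
   e = v - P_W v is mapped to tan^2 theta_d P_W v, which attains the bound. *)

From HB Require Import structures.
Require Import Defs.
From mathcomp Require Import all_boot all_order all_algebra.
From mathcomp Require Import complex ring lra.
From mathcomp Require Import all_classical all_reals all_analysis.

Import Order.TTheory GRing.Theory Num.Theory.
Import numFieldNormedType.Exports.

Local Open Scope classical_set_scope.
Local Open Scope ring_scope.

Section Subspaces.
Context {R : realType} {H : completeNormedModType R[i]}.
Variable dot : {dot H for Num.Def.conjC}.
Implicit Types (V N : set H) (x y z : H).

(** * Linear subsets, spans and orthogonal complements *)

Lemma dotC x y : dot x y = Num.conj (dot y x).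
Proof. by rewrite hermC expr0 mul1r. Qed.

Lemma dot_eq0C x y : dot x y = 0 -> dot y x = 0.
Proof. by move=> xy0; rewrite dotC xy0 rmorph0. Qed.

Lemma dot_self_eq0 x : dot x x = 0 -> x = 0.
Proof. by move/eqP; rewrite dnorm_eq0 => /eqP. Qed.

Definition linear_subset V : Prop :=
  V 0 /\ forall a x y, V x -> V y -> V (a *: x + y).

Lemma linear_subsetZ V a x : linear_subset V -> V x -> V (a *: x).
Proof. by move=> [V0 VP] Vx; rewrite -[_ *: _]addr0; exact: VP. Qed.

Lemma linear_subsetB V x y : linear_subset V -> V x -> V y -> V (x - y).
Proof. by move=> [V0 VP] Vx Vy; rewrite addrC -scaleN1r; exact: VP. Qed.

Lemma linear_subset_span n (b : 'I_n -> H) : linear_subset (lin_span b).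
Proof.
split; first by exists (fun=> 0); rewrite big1 // => i _; rewrite scale0r.
move=> a _ _ [c ->] [c' ->]; exists (fun i => a * c i + c' i).
rewrite scaler_sumr -big_split; apply: eq_bigr => i _ /=.
by rewrite scalerDl scalerA.
Qed.

Lemma linear_subset_orthocompl V : linear_subset (orthocompl dot V).
Proof.
split; first by move=> v _; rewrite linear0l.
move=> a x y Vx Vy v Vv.
by rewrite linearDl linearZl_LR /= (Vx _ Vv) (Vy _ Vv) mulr0 addr0.
Qed.

Lemma lin_span_family n (b : 'I_n -> H) i : lin_span b (b i).
Proof.
exists (fun j => (j == i)%:R); rewrite (bigD1 i) //= eqxx scale1r big1 ?addr0 //.
by move=> j /negPf ->; rewrite scale0r.
Qed.

Lemma orthocompl_spanP n (b : 'I_n -> H) x :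
  orthocompl dot (lin_span b) x <-> forall i, dot x (b i) = 0.
Proof.
split=> [bx i|bx _ [c ->]]; first exact/bx/lin_span_family.
by rewrite linear_sumr big1 // => i _; rewrite linearZr_LR /= bx mulr0.
Qed.

Lemma orthonormal_lin_indep n (u : 'I_n -> H) :
  (forall i j, dot (u i) (u j) = (i == j)%:R) -> lin_indep u.
Proof.
move=> uu c cu0 i; have := linear0l dot (u i).
rewrite -cu0 linear_sumlz (bigD1 i) //= linearZl_LR /= uu eqxx mulr1 big1 ?addr0 //.
by move=> j /negPf ji; rewrite linearZl_LR /= uu ji mulr0.
Qed.

(** The coefficient matrix of [u] over [b] is square, and independence of [u] kills its left kernel;
    inverting it expresses [b] through [u]. *)
Lemma lin_span_indep n (b u : 'I_n -> H) :
  lin_indep u -> (forall i, lin_span b (u i)) -> lin_span b `<=` lin_span u.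
Proof.
move=> iu /choice[M uM] _ [y ->].
pose A := \matrix_(i, j) M i j.
have bE (z : 'rV_n) : \sum_i z 0 i *: u i = \sum_j (z *m A) 0 j *: b j.
  under eq_bigr do rewrite uM scaler_sumr.
  rewrite exchange_big; apply: eq_bigr => j _ /=; rewrite mxE scaler_suml.
  by apply: eq_bigr => i _; rewrite scalerA mxE.
have Aunit : A \in unitmx.
  rewrite -row_free_unit; apply: inj_row_free => z zA; apply/rowP => i.
  rewrite mxE; apply: (iu (z 0)); rewrite bE zA big1 // => j _.
  by rewrite mxE scale0r.
exists ((\row_j y j *m invmx A) 0); rewrite bE mulmxKV //.
by apply: eq_bigr => j _; rewrite mxE.
Qed.

(** A row in the left kernel of the cross Gram matrix [G] would give a vector of the trivial
    intersection, so [G] is invertible and the component solves a linear system. Taking [b' = b]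
    covers orthogonal projections. *)
Lemma oblique_component n (b b' : 'I_n -> H) : lin_indep b ->
  lin_span b `&` orthocompl dot (lin_span b') `<=` [set 0] ->
  forall x, exists y, lin_span b y /\ orthocompl dot (lin_span b') (x - y).
Proof.
move=> ib bb' x; pose G := \matrix_(i, j) dot (b i) (b' j).
have GE (z : 'rV_n) j : dot (\sum_i z 0 i *: b i) (b' j) = (z *m G) 0 j.
  rewrite linear_sumlz mxE; apply: eq_bigr => i _.
  by rewrite linearZl_LR mxE.
have Gunit : G \in unitmx.
  rewrite -row_free_unit; apply: inj_row_free => z zG; apply/rowP => i.
  rewrite mxE; apply: (ib (z 0)); apply: bb'; split; first by exists (z 0).
  by apply/orthocompl_spanP => j; rewrite GE zG mxE.
pose z := \row_j dot x (b' j) *m invmx G.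
exists (\sum_i z 0 i *: b i); split; first by exists (z 0).
by apply/orthocompl_spanP => j; rewrite linearBl /= GE mulmxKV // mxE subrr.
Qed.

(** * Characterization of oblique projections and adjoints *)

Lemma oblique_projP V N x : (exists y, V y /\ N (x - y)) ->
  V (oblique_proj V N x) /\ N (x - oblique_proj V N x).
Proof. by move=> [y yP]; exact: (@xgetI _ 0 [set y | V y /\ N (x - y)] y yP). Qed.

Lemma oblique_proj_eq V N x y : linear_subset V -> linear_subset N ->
  V `&` N `<=` [set 0] -> V y -> N (x - y) -> oblique_proj V N x = y.
Proof.
move=> Vl Nl VN Vy Nxy; apply: xget_unique => // z [Vz Nxz].
apply/eqP; rewrite -subr_eq0; apply/eqP/VN; split; first exact: linear_subsetB.
have -> : z - y = (x - y) - (x - z) by rewrite opprB [RHS]addrC addrA subrK.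
exact: linear_subsetB.
Qed.

Lemma setI_orthocompl V : V `&` orthocompl dot V `<=` [set 0].
Proof. by move=> x [Vx] /(_ _ Vx); exact: dot_self_eq0. Qed.

Lemma adjoint_eq (T : H -> H) y z :
  (forall x, dot (T x) y = dot x z) -> adjoint dot T y = z.
Proof.
move=> Tyz; apply: xget_unique => // z' Tyz'; apply/eqP; rewrite -subr_eq0.
by apply/eqP/dot_self_eq0; rewrite linearBr /= -Tyz -Tyz' subrr.
Qed.

(** * Orthogonal projections onto spans *)

Section OrthogonalProjection.
Context {n : nat} (b : 'I_n -> H).
Hypothesis ib : lin_indep b.
Let V := lin_span b.
Let P := orth_proj dot V.

Lemma orth_projP x : V (P x) /\ orthocompl dot V (x - P x).
Proof.
by apply: oblique_projP; apply: oblique_component => //; exact: setI_orthocompl.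
Qed.

Lemma orth_proj_eq x y : V y -> orthocompl dot V (x - y) -> P x = y.
Proof.
apply: oblique_proj_eq; [exact: linear_subset_span| |exact: setI_orthocompl].
exact: linear_subset_orthocompl.
Qed.

Lemma orth_proj_id x : V x -> P x = x.
Proof.
move=> Vx; apply: orth_proj_eq => //; rewrite subrr.
by case: (linear_subset_orthocompl V).
Qed.

Lemma orth_proj_linear : linear P.
Proof.
move=> a x y; have [Vx Nx] := orth_projP x; have [Vy Ny] := orth_projP y.
apply: orth_proj_eq; first by have [_] := linear_subset_span _ b; exact.
rewrite opprD addrACA -scalerBr.
by have [_] := linear_subset_orthocompl V; exact.
Qed.

Lemma dot_orth_proj x y : V y -> dot (P x) y = dot x y.
Proof.
move=> Vy; have [_ /(_ _ Vy)] := orth_projP x; rewrite linearBl /=.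
by move/subr0_eq.
Qed.

Lemma orth_proj_selfadjoint x y : dot (P x) y = dot x (P y).
Proof.
have [Vx _] := orth_projP x; have [Vy _] := orth_projP y.
by rewrite dotC -(dot_orth_proj y _ Vx) -dotC dot_orth_proj.
Qed.

Lemma dot_orth_proj_self x : dot (P x) (P x) = dot (P x) x.
Proof. by rewrite -orth_proj_selfadjoint orth_proj_id //; case: (orth_projP x). Qed.

End OrthogonalProjection.

(** The vectors of the span orthogonal to all [u j] form a [K]-invariant space, nonzero because
    [m < n]; over the algebraically closed field [R[i]] the restriction of [K] to it has an
    eigenvector. *)
Lemma invariant_eigenvector n m (b : 'I_n -> H) (u : 'I_m -> H)
    (K : {linear H -> H}) :
  lin_indep b -> (m < n)%N -> (forall i, lin_span b (K (b i))) ->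
  (forall x, (forall j, dot x (u j) = 0) -> forall j, dot (K x) (u j) = 0) ->
  exists a x, [/\ x != 0, lin_span b x, forall j, dot x (u j) = 0 & K x = a *: x].
Proof.
move=> ib mn /choice[A KA] Ku.
pose M := \matrix_(i, j) A i j.
pose D := \matrix_(i < n, j < m) dot (b i) (u j).
pose comb (z : 'rV_n) := \sum_i z 0 i *: b i.
have combK (z : 'rV_n) : K (comb z) = comb (z *m M).
  rewrite /comb linear_sum; under eq_bigr do rewrite linearZ /= KA scaler_sumr.
  rewrite exchange_big; apply: eq_bigr => j _ /=; rewrite mxE scaler_suml.
  by apply: eq_bigr => i _; rewrite scalerA mxE.
have combD (z : 'rV_n) j : dot (comb z) (u j) = (z *m D) 0 j.
  rewrite linear_sumlz mxE; apply: eq_bigr => i _.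
  by rewrite linearZl_LR mxE.
(* In coordinates over [b], [M] is the matrix of [K] and [kermx D] describes orthogonality to all
   [u j]. *)
have stab : (row_base (kermx D) *m M <= row_base (kermx D))%MS.
  rewrite eq_row_base; apply/row_subP => i; rewrite row_mul.
  have : (row i (row_base (kermx D)) <= kermx D)%MS.
    by rewrite (submx_trans (row_sub _ _)) ?eq_row_base.
  move: (row i _) => z /sub_kermxP zD; apply/sub_kermxP/rowP => j.
  rewrite -combD -combK mxE; apply: Ku => k.
  by rewrite combD zD mxE.
(* [S] is the matrix of the restricted [K] in the basis [row_base (kermx D)]. *)
have [S MS] := submxP stab.
have kpos : (0 < \rank (kermx D))%N.
  by rewrite mxrank_ker subn_gt0 (leq_ltn_trans (rank_leq_col D)).
have [a /eigenvalueP[y yS y0]] := eigenvalue_closed S kpos.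
pose z := y *m row_base (kermx D); exists a, (comb z); split.
- apply: contra_neq y0 => z0; apply/eqP.
  rewrite -(mulmx_free_eq0 _ (row_base_free (kermx D))); apply/eqP/rowP => i.
  by rewrite [RHS]mxE; exact: (ib (z 0) z0).
- by exists (z 0).
- move=> j; rewrite combD; have /sub_kermxP -> : (z <= kermx D)%MS.
    by rewrite (submx_trans (submxMl _ _)) ?eq_row_base.
  by rewrite mxE.
- rewrite combK /z -mulmxA MS mulmxA yS -scalemxAl /comb scaler_sumr.
  by apply: eq_bigr => i _; rewrite mxE scalerA.
Qed.

(** * Singular values of $P_W P_V$ *)

Section SingularValues.
Context {d : nat} (b b' : 'I_d.+1 -> H).
Hypotheses (ib : lin_indep b) (ib' : lin_indep b').
Let V := lin_span b.
Let W := lin_span b'.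
Let PV := orth_proj dot V.
Let PW := orth_proj dot W.
Hypothesis VW0 : V `&` orthocompl dot W `<=` [set 0].

Let K := PV \o (PW \o PV).

Lemma adjoint_orth_proj_comp x :
  adjoint dot (PW \o PV) ((PW \o PV) x) = K x.
Proof.
have [Wx _] := orth_projP _ ib' (PV x).
apply: adjoint_eq => y; rewrite (dot_orth_proj _ ib') //.
exact: orth_proj_selfadjoint.
Qed.

Lemma dot_comp_selfadjoint x y : dot (K x) y = dot x (K y).
Proof. by rewrite /K /= !orth_proj_selfadjoint -/PV -/PW. Qed.

Lemma dot_comp_self x : V x -> dot (K x) x = dot (PW x) (PW x).
Proof.
move=> Vx; rewrite dot_orth_proj_self // [LHS]orth_proj_selfadjoint //.
by rewrite /= -/PV -/PW [PV x]orth_proj_id.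
Qed.

Lemma orth_proj_range_neq0 x : V x -> x != 0 -> PW x != 0.
Proof.
move=> Vx; apply: contra_neq => Px0; apply: VW0; split=> //.
by have [_] := orth_projP _ ib' x; rewrite -/PW Px0 subr0.
Qed.

Lemma comp_linear : linear K.
Proof. by move=> a x y; rewrite /K /= /PV /PW !orth_proj_linear. Qed.

Variables (s : 'I_d.+1 -> R) (u : 'I_d.+1 -> H).
Hypotheses (s_noninc : {homo s : i j / (i <= j)%N >-> j <= i})
  (uu : forall i j, dot (u i) (u j) = (i == j)%:R)
  (us : forall i, singular_pair dot (PW \o PV) (s i) (u i))
  (s_largest : forall t v, singular_pair dot (PW \o PV) t v ->
     (forall i, dot v (u i) = 0) -> forall i, t <= s i).

Lemma comp_singular_vector i : K (u i) = (s i ^+ 2)%:C%C *: u i.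
Proof. by have [_ _ <-] := us i; rewrite adjoint_orth_proj_comp. Qed.

(* If s ord_max = 0, the d remaining u i leave room in V for an eigenvector v of
   K orthogonal to all of them. Its eigenvalue is positive, so v is orthogonal to
   u ord_max as well and its singular value should be at most s ord_max = 0. *)
Lemma last_singular_value_gt0 : 0 < s ord_max.
Proof.
have [s0 _ _] := us ord_max; rewrite lt_neqAle s0 andbT eq_sym.
apply/eqP => smax0.
pose K' : {linear H -> H} := HB.pack K (GRing.isLinear.Build _ _ _ _ K comp_linear).
have [||a [v [v0 Vv vu Kv]]] :=
    invariant_eigenvector _ d b (u \o lift ord_max) K' ib (ltnSn d).
- by move=> i; have [] := orth_projP _ ib (PW (PV (b i))).
- move=> x xu j; rewrite /= dot_comp_selfadjoint comp_singular_vector.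
  by rewrite linearZr_LR /= xu mulr0.
have {}Kv : K v = a *: v by [].
have a_gt0 : 0 < a.
  have : 0 < a * dot v v.
    have <- : dot (K v) v = a * dot v v by rewrite Kv linearZl_LR.
    by rewrite dot_comp_self // dnorm_gt0 orth_proj_range_neq0.
  by rewrite pmulr_lgt0 // dnorm_gt0.
have vu_all i : dot v (u i) = 0.
  case: (unliftP ord_max i) => [j|] ->; first exact: vu.
  have /eqP : dot (K v) (u ord_max) = 0.
    rewrite dot_comp_selfadjoint comp_singular_vector smax0 expr0n /= scale0r.
    by rewrite linear0r.
  by rewrite Kv linearZl_LR /= mulf_eq0 (gt_eqF a_gt0) => /eqP.
(* Positivity in [R[i]] includes a zero imaginary part, so [a] is the square of a real singular
   value. *)
have aE : a = ((Num.sqrt (complex.Re a)) ^+ 2)%:C%C.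
  move: a_gt0; rewrite ltcE /= => /andP[/eqP Ima Rea].
  by rewrite sqr_sqrtr ?ltW // [LHS]complexE Ima mulr0 addr0.
have sing_v : singular_pair dot (PW \o PV) (Num.sqrt (complex.Re a)) v.
  by split=> //; rewrite -aE adjoint_orth_proj_comp.
have := s_largest _ _ sing_v vu_all ord_max; rewrite smax0 leNgt sqrtr_gt0.
by move: a_gt0; rewrite ltcE /= => /andP[_ ->].
Qed.

(** Every [s i] is at least the positive last one, so [u i] is a multiple of [K (u i)], which lies
    in the range of [PV]. *)
Lemma singular_vector_range i : V (u i).
Proof.
have si_gt0 : 0 < s i.
  by apply: lt_le_trans last_singular_value_gt0 (s_noninc _ _ _); exact: leq_ord.
have [Vu _] := orth_projP _ ib (PW (PV (u i))).
have -> : u i = ((s i ^+ 2)%:C%C)^-1 *: K (u i).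
  rewrite comp_singular_vector scalerA mulVf ?scale1r //.
  by rewrite (inj_eq (@complexI R)) expf_neq0 ?gt_eqF.
by apply: linear_subsetZ => //; exact: linear_subset_span.
Qed.

(** The [u i] are as many orthonormal vectors of [V] as [b] has members, hence a basis. In it the
    right side is $\sum_i s_i^2|c_i|^2$, and the last $s_i$ is the least. *)
Lemma last_singular_value_bound x : V x ->
  (s ord_max ^+ 2)%:C%C * dot x x <= dot (PW x) (PW x).
Proof.
move=> Vx; rewrite -dot_comp_self //.
have [c cE] := lin_span_indep _ _ _ (orthonormal_lin_indep _ _ uu)
  singular_vector_range x Vx.
have xu i : dot x (u i) = c i.
  rewrite cE linear_sumlz (bigD1 i) //= linearZl_LR /= uu eqxx mulr1 big1 ?addr0 //.
  by move=> j /negPf ji; rewrite linearZl_LR /= uu ji mulr0.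
have xy y : dot y x = \sum_i Num.conj (c i) * dot y (u i).
  by rewrite {1}cE linear_sumr; apply: eq_bigr => i _; rewrite linearZr_LR.
rewrite !xy mulr_sumr; apply: ler_sum => i _.
rewrite dot_comp_selfadjoint comp_singular_vector [dot x (_ *: _)]linearZr_LR /= xu.
rewrite (geC0_conj (_ : 0 <= (s i ^+ 2)%:C%C)) ?ler0c ?sqr_ge0 // [leRHS]mulrCA ler_wpM2r //.
  by rewrite mulrC -normCK exprn_ge0.
have [s_ge0 _ _] := us ord_max.
rewrite lecR ler_pXn2r ?nnegrE ?s_noninc ?leq_ord //.
by rewrite (le_trans s_ge0) ?s_noninc ?leq_ord.
Qed.

End SingularValues.

(** * The real norm induced by the inner product *)

Hypothesis norm_dot : forall x : H, `|x| ^+ 2 = dot x x.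

Lemma rnorm_ge0 x : 0 <= rnorm x.
Proof. by have := normr_ge0 x; rewrite lecE => /andP[]. Qed.

Lemma dot_rnorm x : dot x x = (rnorm x ^+ 2)%:C%C.
Proof.
by rewrite -norm_dot /rnorm rmorphXn /= RRe_real ?normr_real.
Qed.

Lemma rnorm_gt0 x : x != 0 -> 0 < rnorm x.
Proof.
move=> x0; rewrite lt_neqAle rnorm_ge0 andbT eq_sym; apply: contra_neq x0 => x0.
by apply: dot_self_eq0; rewrite dot_rnorm x0 expr0n.
Qed.

(** * The oblique projection restricted to $W^\perp$ *)

Section ConsistentSampling.
Context {d : nat} (b b' : 'I_d.+1 -> H).
Hypotheses (ib : lin_indep b) (ib' : lin_indep b').
Let V := lin_span b.
Let W := lin_span b'.
Hypothesis VW : direct_sum_eq_all V (orthocompl dot W).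
Let Q := oblique_proj W (orthocompl dot V).

(** Split along $V\oplus W^\perp$, such a [w] is orthogonal to both of its components, hence to
    itself. *)
Lemma direct_sum_dual : W `&` orthocompl dot V `<=` [set 0].
Proof.
move=> w [Ww Vw]; apply: dot_self_eq0.
have [v Vv [n Wn wE]] : [set v + n | v in V & n in orthocompl dot W] w.
  by have [-> _] := VW.
rewrite -{2}wE linearDr /= (Vw _ Vv) add0r; apply: dot_eq0C; exact: Wn.
Qed.

Lemma consistent_samplingP x : W (Q x) /\ orthocompl dot V (x - Q x).
Proof.
by apply: oblique_projP; apply: oblique_component => //; exact: direct_sum_dual.
Qed.

(** These stand for $\cos\theta_d$ and $\tan\theta_d$; trigonometry enters only through [ct]. *)
Variables c t : R.
Hypotheses (c_gt0 : 0 < c) (t_ge0 : 0 <= t) (ct : c ^+ 2 * (1 + t ^+ 2) = 1).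

Lemma consistent_sampling_le e :
  (forall v, V v ->
    (c ^+ 2)%:C%C * dot v v <= dot (orth_proj dot W v) (orth_proj dot W v)) ->
  orthocompl dot W e -> rnorm (Q e) <= t * rnorm e.
Proof.
move=> cV We; have [] := consistent_samplingP e; set w := Q e => Ww Vew.
have [v Vv [n Wn wE]] : [set v + n | v in V & n in orthocompl dot W] w.
  by have [-> _] := VW.
have vE : v = w - n by rewrite -wE addrK.
have Pv : orth_proj dot W v = w.
  apply: orth_proj_eq => //; rewrite -wE opprD addrA subrr sub0r -scaleN1r.
  by apply: (linear_subsetZ (orthocompl dot W)) => //; exact: linear_subset_orthocompl.
have wn : dot w n = 0 by exact/dot_eq0C/Wn.
(* By Pythagoras the hypothesis on [v] reads $c^2(|w|^2+|n|^2)\le|w|^2$, and [ct] turns the right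
   side into $c^2(1+t^2)|w|^2$. *)
have nt : rnorm n ^+ 2 <= t ^+ 2 * rnorm w ^+ 2.
  have := cV _ Vv; rewrite Pv vE hnormBd //= !dot_rnorm -!rmorphD -!rmorphM lecR.
  move=> H1; have c2_gt0 : 0 < c ^+ 2 by rewrite exprn_gt0.
  have := congr1 (fun r : R => r * rnorm w ^+ 2) ct; rewrite -(ler_pM2l c2_gt0) /=; nra.
(* Expand $\langle e-w,w-n\rangle=0$ with $\langle e,w\rangle=\langle w,n\rangle=0$. *)
have en : dot e n = - (rnorm w ^+ 2)%:C%C.
  have := Vew _ Vv; rewrite vE linearBl !linearBr /= We // wn dot_rnorm.
  by rewrite sub0r subr0 => /subr0_eq <-; rewrite opprK.
have : 0 <= rnorm ((t ^+ 2)%:C%C *: e + n) ^+ 2 by rewrite sqr_ge0.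
rewrite -lecR -dot_rnorm dnormD dnormZ linearZl_LR /= en -!rmorphN -!rmorphM /=.
rewrite conj_Creal ?complex_real // ger0_norm ?ler0c ?sqr_ge0 // !dot_rnorm.
rewrite -!rmorphXn -!rmorphM -!rmorphD lecR => ge0.
(* The final step cancels $t^2$; for $t=0$, [nt] gives $n=0$ and then [en] gives $w=0$. *)
have [t0|t_neq0] := eqVneq t 0.
  have n0 : dot n n = 0.
    apply/eqP; rewrite dot_rnorm (inj_eq (@complexI R)).
    by rewrite eq_le sqr_ge0 andbT; move: nt; rewrite t0 expr0n mul0r.
  have : dot w w = 0.
    by rewrite dot_rnorm -[LHS]opprK -en (dot_self_eq0 _ n0) linear0r oppr0.
  move/eqP; rewrite dot_rnorm (inj_eq (@complexI R)) sqrf_eq0 => /eqP ->.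
  by rewrite t0 mul0r.
have t2_gt0 : 0 < t ^+ 2 by rewrite exprn_gt0 // lt_neqAle eq_sym t_neq0.
rewrite -(ler_pXn2r (ltn0Sn 1)) ?nnegrE ?mulr_ge0 ?rnorm_ge0 // exprMn.
(* ge0 is |t^2 e + n|^2 >= 0, i.e. Cauchy-Schwarz for e and n with the weight
   t^2 adapted to nt. *)
rewrite -(ler_pM2l t2_gt0); nra.
Qed.

(** The eigenvalue equation makes $w=P_Wv$ act on $V$ as $c^2v$, so by [ct] the vector
    $e-t^2w=v-(1+t^2)w$ is orthogonal to $V$ and [Q e] is $t^2w$. The norms follow from $|w|=c|v|$
    and Pythagoras. *)
Lemma consistent_sampling_eq v : V v ->
  orth_proj dot V (orth_proj dot W v) = (c ^+ 2)%:C%C *: v ->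
  let e := v - orth_proj dot W v in
  orthocompl dot W e /\ rnorm (Q e) = t * rnorm e /\ rnorm e = t * c * rnorm v.
Proof.
move=> Vv Kv; have [] := orth_projP _ ib' v.
set w := orth_proj dot W v => Ww We; set e := v - w; split => //.
have wV v' : V v' -> dot w v' = (c ^+ 2)%:C%C * dot v v'.
  by move=> Vv'; rewrite -(dot_orth_proj _ ib _ _ Vv') -/V Kv linearZl_LR.
have Qe : Q e = (t ^+ 2)%:C%C *: w.
  apply: oblique_proj_eq.
  - exact: linear_subset_span.
  - exact: linear_subset_orthocompl.
  - exact: direct_sum_dual.
  - by apply: linear_subsetZ => //; exact: linear_subset_span.
  move=> v' Vv'; rewrite !linearBl linearZl_LR /= wV //.
  rewrite -[X in X - _ - _]mul1r -[1](rmorph1 (real_complex R)) -ct.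
  rewrite rmorphM rmorphD rmorph1.
  ring.
have ww : rnorm w ^+ 2 = c ^+ 2 * rnorm v ^+ 2.
  have : dot w w = (c ^+ 2)%:C%C * dot v v by rewrite -wV // dot_orth_proj_self.
  by rewrite !dot_rnorm -rmorphM => /(@complexI R).
have ee : rnorm e ^+ 2 = (t * c * rnorm v) ^+ 2.
  have vv : dot v v = dot e e + dot w w.
    by rewrite -[in LHS](subrK w v) hnormDd //; exact: We.
  move: vv; rewrite !dot_rnorm -rmorphD => /(@complexI R); rewrite ww => vv.
  have := congr1 (fun r : R => r * rnorm v ^+ 2) ct; rewrite /= !exprMn; nra.
have rw : rnorm w = c * rnorm v.
  apply/eqP; rewrite -(eqrXn2 (ltn0Sn 1)) ?mulr_ge0 ?mulr_ge0 ?rnorm_ge0 ?(ltW c_gt0) //.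
  by rewrite ww exprMn.
have re : rnorm e = t * c * rnorm v.
  by apply/eqP; rewrite -(eqrXn2 (ltn0Sn 1)) ?mulr_ge0 ?mulr_ge0 ?rnorm_ge0 ?(ltW c_gt0) // ee.
split=> //; rewrite re Qe.
apply/eqP; rewrite -(eqrXn2 (ltn0Sn 1)) ?mulr_ge0 ?mulr_ge0 ?rnorm_ge0 ?(ltW c_gt0) //.
apply/eqP/(@complexI R); rewrite -dot_rnorm dnormZ dot_rnorm rw.
rewrite ger0_norm ?ler0c ?sqr_ge0 // -rmorphXn -rmorphM /=; congr (_%:C)%C; ring.
Qed.

End ConsistentSampling.
End Subspaces.

(** * Evaluation of the aliasing norm *)

Theorem corollary5p2 (R : realType) (H : completeNormedModType R[i])
    (dot : {dot H for Num.Def.conjC})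
    (norm_dot : forall x : H, `|x| ^+ 2 = dot x x)
    (sepH : separable_space H)
    (d : nat) (V W : set H)
    (dimV : subspace_of_dim V d.+1) (dimW : subspace_of_dim W d.+1)
    (VW : direct_sum_eq_all V (orthocompl dot W))
    (theta : 'I_d.+1 -> R) (angles : principal_angles dot V W theta) :
  aliasing_norm dot W V = (tan (theta ord_max))%:E.
Proof.
have [b ib VE] := dimV; have [b' ib' WE] := dimW.
rewrite {V dimV}VE {W dimW}WE in VW angles *.
have [theta_range _ [s_noninc [u [/orthonormalP[u_uniq u_on] us s_largest]]]] := angles.
have uu i j : dot (u i) (u j) = (i == j)%:R.
  by rewrite u_on ?codom_f // (inj_eq (injectiveP _ u_uniq)).
have VW0 : lin_span b `&` orthocompl dot (lin_span b') `<=` [set 0].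
  by have [_ ->] := VW.
set t := tan (theta ord_max); pose c := cos (theta ord_max).
(* The definition of the angles allows $\pi/2$; positivity of the last singular value excludes it
   for $\theta_d$. *)
have c_gt0 : 0 < c by exact: (last_singular_value_gt0 dot b b' ib ib' VW0 _ u us s_largest).
have t_ge0 : 0 <= t.
  have /andP[th0 thpi] := theta_range ord_max.
  rewrite divr_ge0 ?(ltW c_gt0) // sin_ge0_pi // th0 (le_trans thpi) //.
  by rewrite ler_pdivrMr // ler_peMr ?pi_ge0 // ler1n.
have ct : c ^+ 2 * (1 + t ^+ 2) = 1.
  by rewrite -cos2_tan2 ?gt_eqF // mulfV // expf_neq0 // gt_eqF.
have rangeV := singular_vector_range dot b b' ib ib' VW0 _ u s_noninc us s_largest.
pose v := u ord_max; have Vv : lin_span b v by exact: rangeV.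
have Kv : orth_proj dot (lin_span b) (orth_proj dot (lin_span b') v) =
    (c ^+ 2)%:C%C *: v.
  rewrite -(comp_singular_vector dot b b' ib ib' _ u us ord_max) /=.
  by rewrite (orth_proj_id dot b (u ord_max)).
have v1 : rnorm v = 1.
  apply/eqP; rewrite -(eqrXn2 (ltn0Sn 1)) ?rnorm_ge0 // expr1n.
  by rewrite -(inj_eq (@complexI R)) -(dot_rnorm dot) // uu eqxx.
have [] := consistent_sampling_eq dot norm_dot b b' ib ib' VW c t c_gt0 t_ge0 ct v Vv Kv.
set e := v - _; rewrite v1 mulr1 => We [Qe ee].
rewrite /aliasing_norm; case: asboolP => [W0|W_neq0].
  (* Here $0=|e|=tc$ with $c>0$, so $t=0$ agrees with the convention. *)
  have e0 : e = 0 by move: We; rewrite W0.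
  move: ee; rewrite e0 /rnorm normr0 /= => /esym/eqP.
  by rewrite mulf_eq0 (gt_eqF c_gt0) orbF => /eqP ->.
apply/le_anti/andP; split.
  apply: ub_ereal_sup => _ [x [Wx /eqP x0] <-].
  rewrite lee_fin ler_pdivrMr ?(rnorm_gt0 dot) //.
  apply: (consistent_sampling_le dot norm_dot b b' ib' VW c t) => // y Vy.
  exact: (last_singular_value_bound dot b b' ib ib' VW0 _ u s_noninc uu us s_largest).
(* If $t=0$ then $e=0$ is no admissible witness; any nonzero vector of $W^\perp$ has a ratio at
   least $0=t$. *)
have [t0|t_neq0] := eqVneq t 0.
  have [x [Wx x0]] : exists x, orthocompl dot (lin_span b') x /\ x <> 0.
    apply: contrapT => /forallNP W0; apply: W_neq0; apply/seteqP; split => x.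
      by move=> Wx; apply: contrapT => x0; apply: (W0 x).
    by move=> ->; case: (linear_subset_orthocompl dot (lin_span b')).
  apply: le_trans (ereal_sup_ubound _); last by exists x.
  by rewrite t0 lee_fin divr_ge0 ?rnorm_ge0.
apply: ereal_sup_ubound; exists e.
  split=> // e0; move: ee; rewrite e0 /rnorm normr0 /= => /esym/eqP.
  by rewrite mulf_eq0 (gt_eqF c_gt0) (negPf t_neq0).
by rewrite Qe mulfK // ee mulf_neq0 // gt_eqF.
Qed.
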